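(* Let $T$ be a bounded, linear, self-adjoint operator on $L^2(G,\mathbb{C}^{s\times r})$ that is adjointable with respect to the matrix-valued inner product, and let $\{E_k\}_{k\in\mathbb{N}}$ be a matrix-valued orthonormal basis for $L^2(G,\mathbb{C}^{s\times r})$. Then $$\Big\{\big(I+\tfrac12\big((T^2)^{1/2}+T\big)\big)E_k\Big\}_{k\in\mathbb{N}}\quad\text{and}\quad\Big\{\big(I+\tfrac12\big((T^2)^{1/2}-T\big)\big)E_k\Big\}_{k\in\mathbb{N}}$$ are matrix-valued Riesz bases for $L^2(G,\mathbb{C}^{s\times r})$, where $I$ is the identity operator.
   Context: $G$ is a locally compact abelian group that is metrizable and $\sigma$-compact, with Haar measure $\mu_G$; $s,r\in\mathbb{N}$. $L^2(G,\mathbb{C}^{s\times r})$ is the space of $s\times r$ matrices with all entries in $L^2(G)$. The matrix-valued inner product is $\langle \mathbf{f},\mathbf{g}\rangle=\int_G \mathbf{f}(x)\mathbf{g}^*(x)\,d\mu_G\in M_s(\mathbb{C})$ (entrywise integral). $L^2(G,\mathbb{C}^{s\times r})$ is a Hilbert space with inner product $\langle \mathbf{f},\mathbf{g}\rangle_{L^2}=\mathrm{tr}\langle \mathbf{f},\mathbf{g}\rangle$ and Frobenius norm; $U^*$ denotes the Hilbert-adjoint with respect to this inner product, and self-adjoint means $T^*=T$. $U$ is adjointable with respect to the matrix-valued inner product if $\langle U\mathbf{f},\mathbf{g}\rangle=\langle\mathbf{f},U^*\mathbf{g}\rangle$ for all $\mathbf{f},\mathbf{g}$. For a positive operator $P$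 ($P^*=P$, $\mathrm{tr}\langle P\mathbf{f},\mathbf{f}\rangle\ge0$ for all $\mathbf{f}$), $P^{1/2}$ is the unique bounded positive operator whose square is $P$. A matrix-valued orthonormal basis is a sequence $\{E_k\}_{k\in\mathbb{N}}$ with $\langle E_k,E_j\rangle=\mathbf{I}_{s\times s}$ if $k=j$ and $\mathbf{O}_{s\times s}$ otherwise, such that $\mathbf{f}=\sum_k\langle\mathbf{f},E_k\rangle E_k$ in Frobenius norm for all $\mathbf{f}$. A matrix-valued Riesz basis is a family $\{VE_k\}_{k\in\mathbb{N}}$ with $\{E_k\}$ a matrix-valued orthonormal basis and $V$ bounded, linear, bijective and adjointable with respect to the matrix-valued inner product. *)

(* Defs.v *)
From HB Require Import structures.
From mathcomp Require Import all_boot all_order all_algebra.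
From mathcomp Require Import all_classical all_reals all_analysis.
From mathcomp.real_closed Require Import complex.
Set Implicit Arguments. Unset Strict Implicit. Unset Printing Implicit Defensive.
Import Order.TTheory GRing.Theory Num.Theory.
Import numFieldNormedType.Exports.
Local Open Scope classical_set_scope.
Local Open Scope ring_scope.

Definition ptZ (G : topologicalZmodType) : Type := G.
HB.instance Definition _ (G : topologicalZmodType) := Choice.on (ptZ G).
HB.instance Definition _ (G : topologicalZmodType) :=
  isPointed.Build (ptZ G) (0 : G).
Notation borelType G := (g_sigma_algebraType (@open G : set (set (ptZ G)))).

Section LCA.
Context (R : realType) (G : topologicalZmodType).

Definition metrizable_top : Prop :=
  exists dist : G -> G -> R,
    [/\ (forall x y, 0 <= dist x y),
        (forall x y, dist x y = 0 <-> x = y),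
        (forall x y, dist x y = dist y x),
        (forall x y z, dist x z <= dist x y + dist y z) &
        (forall A : set G, open A <->
           (forall x, A x -> exists2 e : R, 0 < e & [set y | dist x y < e] `<=` A))].

Definition loc_compact : Prop :=
  forall x : G, exists K : set G, compact K /\ nbhs x K.

Definition sigma_compact : Prop :=
  exists K : nat -> set G, (forall n, compact (K n)) /\ \bigcup_n K n = setT.

(* Haar measure on the (metrizable, sigma-compact) LCA group G: a nonzero-on-opens,
   translation invariant Borel measure, finite on compact sets (such a measure is
   automatically Radon in the metrizable sigma-compact case). *)
Definition haar_measure (mu : {measure set (borelType G) -> \bar R}) : Prop :=
  [/\ (forall (x : G) (A : set G), measurable (A : set (borelType G)) ->
          mu [set x + a | a in A] = mu A),
      (forall K : set G, compact K -> (mu K < +oo)%E) &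
      (forall U : set G, open U -> U !=set0 -> (0 < mu U)%E)].

End LCA.

Local Open Scope complex_scope.

Section L2.
Context (R : realType) (G : topologicalZmodType)
  (mu : {measure set (borelType G) -> \bar R}) (s r : nat).

Notation C := (R[i]).
(* elements of L^2(G, C^{s x r}) are represented by functions, identified a.e. *)
Notation Fn := (borelType G -> 'M[C]_(s, r)).
Notation Op := (Fn -> Fn).

Definition cint (h : borelType G -> C) : C :=
  (Rintegral mu setT (fun x => complex.Re (h x))) +i* (Rintegral mu setT (fun x => complex.Im (h x))).

Definition ctr (A : 'M[C]_(s, r)) : 'M[C]_(r, s) := \matrix_(i, j) conjc (A j i).

Definition L2 (f : Fn) : Prop :=
  forall i j,
    [/\ measurable_fun setT (fun x => complex.Re (f x i j)),
        measurable_fun setT (fun x => complex.Im (f x i j)) &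
        mu.-integrable setT (fun x => ((complex.Re (f x i j)) ^+ 2 + (complex.Im (f x i j)) ^+ 2)%:E)].

Definition mip (f g : Fn) : 'M[C]_s :=
  \matrix_(i, j) cint (fun x => (f x *m ctr (g x)) i j).

Definition ip (f g : Fn) : C := \tr (mip f g).
Definition nsq (f : Fn) : R := complex.Re (ip f f).

Definition fsub (f g : Fn) : Fn := fun x => f x - g x.

Definition aeq (f g : Fn) : Prop := nsq (fsub f g) = 0.

Definition blop (U : Op) : Prop :=
  [/\ (forall f, L2 f -> L2 (U f)),
      (forall f g, L2 f -> L2 g -> aeq f g -> aeq (U f) (U g)),
      (forall (a : C) f g, L2 f -> L2 g ->
          aeq (U (fun x => a *: f x + g x)) (fun x => a *: U f x + U g x)) &
      (exists K : R, forall f, L2 f -> nsq (U f) <= K * nsq f)].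

Definition is_hadjoint (U V : Op) : Prop :=
  forall f g, L2 f -> L2 g -> ip (U f) g = ip f (V g).

Definition selfadjoint (U : Op) : Prop := is_hadjoint U U.

Definition mx_adjointable (U : Op) : Prop :=
  exists V : Op, [/\ blop V, is_hadjoint U V &
    forall f g, L2 f -> L2 g -> mip (U f) g = mip f (V g)].

Definition positive_op (P : Op) : Prop :=
  [/\ blop P, selfadjoint P & forall f, L2 f -> 0 <= ip (P f) f].

(* S is the (unique) bounded positive square root P^{1/2} of P *)
Definition is_pos_sqrt (P S : Op) : Prop :=
  positive_op S /\ forall f, L2 f -> aeq (S (S f)) (P f).

Definition L2_bijective (V : Op) : Prop :=
  (forall f g, L2 f -> L2 g -> aeq (V f) (V g) -> aeq f g) /\
  (forall g, L2 g -> exists2 f, L2 f & aeq (V f) g).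

Definition mx_onb (E : nat -> Fn) : Prop :=
  [/\ (forall k, L2 (E k)),
      (forall k j, mip (E k) (E j) = if k == j then 1%:M else 0) &
      (forall f, L2 f ->
         (fun n => nsq (fsub f (fun x => \sum_(k < n) mip f (E k) *m E k x)))
           @ \oo --> 0)].

Definition mx_riesz (F : nat -> Fn) : Prop :=
  exists (E : nat -> Fn) (V : Op),
    [/\ mx_onb E, blop V, L2_bijective V, mx_adjointable V &
        forall k, aeq (F k) (V (E k))].

End L2.

(* Main.v *)
(** Write [<f, g>] for the matrix-valued inner product. A bounded operator that is self-adjoint
    for [tr <., .>] and commutes with left multiplication by matrices satisfies
    [<U f, g> = <f, U g>], so the point is that [S = (T^2)^(1/2)] also has this property and that
    [S + T] and [S - T] are positive: then [1 + (S + T)/2] and [1 + (S - T)/2] are coercive, hence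
    bijective by completeness of L^2.

    Both facts follow from one form of the Loewner-Heinz inequality: if [S >= 0], [U] is
    self-adjoint and [|U f| <= |S f|] for all [f], then [U <= S]. Otherwise let [-c < 0] be the
    infimum of the numerical range of [S - U] and [f] an approximate eigenvector for it; then
    [Re <(S - U) f, (S + U) f> = |S f|^2 - |U f|^2 >= 0] is close to [-c Re <f, (S + U) f>], which
    is at most about [-c^2 |f|^2 < 0] because [(S - U) + (S + U) = 2 S >= 0]. Applied to [U = T] and [U = -T] it gives
    positivity. Applied twice to [S] and its conjugate by left multiplication with a unitary
    matrix, which has the same square, it shows that the two agree; as unitary matrices span all
    matrices, [S] commutes with left multiplication by matrices. *)
Require Import Defs.
From HB Require Import structures.
From mathcomp Require Import all_boot all_order all_algebra all_fingroup.
From mathcomp Require Import all_classical all_reals all_analysis measurable_realfun.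
From mathcomp.real_closed Require Import complex.
From mathcomp Require Import ring lra.
Set Implicit Arguments. Unset Strict Implicit. Unset Printing Implicit Defensive.
Import Order.TTheory GRing.Theory Num.Theory.
Import numFieldNormedType.Exports.
Local Open Scope classical_set_scope.
Local Open Scope ring_scope.
Local Open Scope complex_scope.

(** * Symmetric operators on real semi-inner product spaces *)

Section SemiInner.
Context (R : realType) (V : lmodType R[i]).
Implicit Types (b : V -> V -> R) (f g h : V) (U S T P : V -> V).

(** The form is real-valued on a complex module: it will be the real part of the trace inner
    product. It is only semidefinite, because functions are not quotiented by a.e. equality, so
    identities between vectors are stated by pairing with an arbitrary vector. *)
Definition psform b :=
  [/\ forall f g, b f g = b g f,
      forall f g h, b (f + g) h = b f h + b g h,
      forall (a : R) f h, b (a%:C *: f) h = a * b f h &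
      forall f, 0 <= b f f].

(** Operators are plain maps. Symmetry alone makes them real linear up to null vectors, since [U]
    can be moved onto the other argument; this weak linearity replaces a linearity assumption
    below. *)
Definition symop b U := forall f g, b (U f) g = b f (U g).
Definition bddop b U := exists K, forall f, b (U f) (U f) <= K * b f f.

Section Form.
Context b (psb : psform b).

Lemma psC f g : b f g = b g f. Proof. by case: psb. Qed.
Lemma psDl f g h : b (f + g) h = b f h + b g h. Proof. by case: psb. Qed.
Lemma psZl (a : R) f h : b (a%:C *: f) h = a * b f h. Proof. by case: psb. Qed.
Lemma ps_ge0 f : 0 <= b f f. Proof. by case: psb. Qed.
Lemma psDr f g h : b h (f + g) = b h f + b h g.
Proof. by rewrite !(psC h) psDl. Qed.
Lemma psZr (a : R) f h : b h (a%:C *: f) = a * b h f.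
Proof. by rewrite !(psC h) psZl. Qed.
Lemma psNl f h : b (- f) h = - b f h.
Proof. by rewrite -scaleN1r -[X in X *: f](rmorphN1 (real_complex R)) psZl mulN1r. Qed.
Lemma psNr f h : b h (- f) = - b h f.
Proof. by rewrite !(psC h) psNl. Qed.

Definition psE := (psDl, psDr, psNl, psNr, psZl, psZr).

Lemma ps_CauchySchwarz f g : b f g ^+ 2 <= b f f * b g g.
Proof.
have [g0|g0] := eqVneq (b g g) 0.
  rewrite g0 mulr0; have [->|n0] := eqVneq (b f g) 0; first by rewrite expr0n.
  (* When [b g g = 0] the form is affine along [f + t g]; this [t] is the point where it would take
     the value [-1]. *)
  have := ps_ge0 (f + ((- (b f f + 1)) / (2 * b f g))%:C *: g).
  rewrite !psE (psC g f) g0.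
  rewrite [X in 0 <= X](_ : _ = - 1); first by lra.
  by field.
have gp : 0 < b g g by rewrite lt_def g0 ps_ge0.
have := ps_ge0 ((b g g)%:C *: f - (b f g)%:C *: g).
rewrite !psE (psC g f).
rewrite [X in 0 <= X -> _](_ : _ = b g g * (b f f * b g g - b f g ^+ 2)); last by ring.
by rewrite pmulr_rge0// subr_ge0.
Qed.

Lemma ps_null f g : b f f = 0 -> b f g = 0.
Proof.
move=> f0; have := ps_CauchySchwarz f g.
by rewrite f0 mul0r => h; apply/eqP; rewrite -sqrf_eq0 eq_le h sqr_ge0.
Qed.

Lemma ps_sqrD f g : b (f + g) (f + g) <= 2 * b f f + 2 * b g g.
Proof. by have := ps_ge0 (f - g); rewrite !psE (psC g f); lra. Qed.

Lemma ps_AMGM f g : 2 * b f g <= b f f + b g g.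
Proof. by have := ps_ge0 (f - g); rewrite !psE (psC g f); lra. Qed.

Lemma symopD S T : symop b S -> symop b T -> symop b (fun f => S f + T f).
Proof. by move=> s t f g; rewrite !psE s t. Qed.

Lemma symopN S : symop b S -> symop b (fun f => - S f).
Proof. by move=> s f g; rewrite !psE s. Qed.

Lemma symopZ (a : R) S : symop b S -> symop b (fun f => a%:C *: S f).
Proof. by move=> s f g; rewrite !psE s. Qed.

Lemma bddop_ge0 T : bddop b T ->
  exists2 K, 0 <= K & forall f, b (T f) (T f) <= K * b f f.
Proof.
move=> [K TK]; exists `|K| => // f; apply: le_trans (TK f) _.
by rewrite ler_wpM2r ?ps_ge0 ?ler_norm.
Qed.

Lemma bddopD S T : bddop b S -> bddop b T -> bddop b (fun f => S f + T f).
Proof.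
move=> [K SK] [L TL]; exists (2 * K + 2 * L) => f.
apply: le_trans (ps_sqrD _ _) _.
by have := SK f; have := TL f; lra.
Qed.

Lemma bddop_id : bddop b id.
Proof. by exists 1 => f; rewrite mul1r. Qed.

Lemma symop_form P : symop b P -> (forall f, 0 <= b (P f) f) ->
  psform (fun f g => b (P f) g).
Proof.
move=> sP P0; split=> // [f g|f g h|a f h]; first by rewrite sP psC.
- by rewrite sP !psE !sP.
- by rewrite sP !psE !sP.
Qed.

End Form.

(** Cauchy-Schwarz for the form [b (Q f) g], applied to [f] and [Q f], gives
    [|Q f|^4 <= b (Q f) f * b (Q (Q f)) (Q f)]. The last factor is at most [L |Q f|^2], and one
    [|Q f|^2] cancels. *)
Lemma pos_sqr_le b Q (L : R) : 0 <= L -> psform b -> symop b Q ->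
  (forall f, 0 <= b (Q f) f) -> (forall f, b (Q f) f <= L * b f f) ->
  forall f, b (Q f) (Q f) <= L * b (Q f) f.
Proof.
move=> L0 psb sQ Q0 QL f.
have := ps_CauchySchwarz (symop_form psb sQ Q0) f (Q f).
have := QL (Q f); have := Q0 f; have := ps_ge0 psb (Q f); rewrite /=.
move: (b (Q f) f) (b (Q (Q f)) (Q f)) (b (Q f) (Q f)) => x y z z0 x0 yz zz.
have [->|zn] := eqVneq z 0.
  by rewrite mulr_ge0.
have {z0 zn} zp : 0 < z by rewrite lt_def zn.
have : z * z <= z * (L * x) by nra.
by rewrite ler_pM2l.
Qed.


(** Quantitative contradiction: if [-c < 0] is the infimum of the numerical range of [P] and [f]
    attains it up to [e], then [Q = P + c] is positive and [|Q f|^2] is of order [e] by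
    [pos_sqr_le]. So [b (Q f) (N f)] is of order [sqrt e], although it is at least
    [c (c - e) b f f]. *)
Lemma heinz b S T : psform b -> symop b S -> symop b T -> bddop b S ->
  (forall f, 0 <= b (S f) f) -> (forall f, b (T f) (T f) <= b (S f) (S f)) ->
  forall f, b (T f) f <= b (S f) f.
Proof.
move=> psb sS sT bS S0 TS f0.
have [K K0 SK] := bddop_ge0 psb bS.
have b0 := ps_ge0 psb.
pose P f := S f - T f; pose N f := S f + T f.
have sP : symop b P by apply: symopD => //; exact: symopN.
have NK f : b (N f) (N f) <= 4 * K * b f f.
  apply: le_trans (ps_sqrD psb _ _) _.
  by have := SK f; have := TS f; lra.
have PK f : b (P f) (P f) <= 4 * K * b f f.
  apply: le_trans (ps_sqrD psb _ _) _; rewrite !(psE psb) opprK.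
  by have := SK f; have := TS f; lra.
pose M := 4 * K + 1; have M0 : 0 <= M by rewrite /M; lra.
have PM f : b (P f) f <= M * b f f.
  by have := ps_AMGM psb (P f) f; have := PK f; have := b0 f; have := mulr_ge0 K0 (b0 f); rewrite /M; lra.
have PM' f : - M * b f f <= b (P f) f.
  have := ps_AMGM psb (- P f) f; rewrite !(psNl psb, psNr psb) opprK.
  by have := PK f; have := b0 f; have := mulr_ge0 K0 (b0 f); rewrite /M; lra.
suff P0 : 0 <= b (P f0) f0 by move: P0; rewrite !(psE psb) subr_ge0.
rewrite leNgt; apply/negP => Pf0.
pose A := [set c : R | 0 <= c /\ forall f, - c * b f f <= b (P f) f].
have A0 : A !=set0 by exists M.
have lbA : has_lbound A by exists 0 => c [].
pose c := inf A.
have c0 : 0 <= c by apply: lb_le_inf => // x [].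
have Pc f : - c * b f f <= b (P f) f.
  (* The infimum itself belongs to [A]. The slack is divided by [b f f + 1], not by [b f f], which
     may vanish. *)
  apply/ler_addgt0Pr => e e0.
  have [] := @inf_adherent _ A (e / (b f f + 1)) _ (conj A0 lbA).
    by rewrite divr_gt0// ltr_wpDl.
  move=> x [x0 Px]; rewrite -/c => xc.
  have := Px f; have bf := b0 f.
  have : x * b f f <= c * b f f + e.
    have : x * b f f <= (c + e / (b f f + 1)) * b f f by rewrite ler_wpM2r// ltW.
    have : e / (b f f + 1) * b f f <= e.
      rewrite mulrAC ler_pdivrMr ?ltr_wpDl// ler_pM2l//; lra.
    lra.
  lra.
have {c0} c0 : 0 < c.
  rewrite lt_def c0 andbT; apply/eqP => cE.
  by have := Pc f0; rewrite cE oppr0 mul0r; lra.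
pose Q f := P f + c%:C *: f.
have sQ : symop b Q by apply: symopD => //; apply: symopZ.
have Q0 f : 0 <= b (Q f) f by rewrite !(psE psb); have := Pc f; rewrite !(psE psb); lra.
pose L := M + c; have L0 : 0 <= L by rewrite /L; lra.
have QL f : b (Q f) f <= L * b f f.
  by rewrite (psDl psb) (psZl psb) /L; have := PM f; lra.
have QQ := pos_sqr_le L0 psb sQ Q0 QL.
(* The first bound gives [(c (c - e))^2 >= c^4 / 4], the second [4 K L e <= c^4 / 8]; the two are
   incompatible with the final comparison. *)
pose e := Num.min (c / 2) (c ^+ 4 / (32 * (K * L + 1))).
have KL0 : 0 <= K * L by rewrite mulr_ge0.
have e0 : 0 < e by rewrite /e lt_min !divr_gt0 ?exprn_gt0// mulr_gt0// ltr_wpDl.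
have ec : e <= c / 2 by rewrite /e ge_min lexx.
have ec4 : 32 * (K * L + 1) * e <= c ^+ 4.
  by rewrite mulrC -ler_pdivlMr ?mulr_gt0 ?ltr_wpDl// /e ge_min lexx orbT.
have [f Pf] : exists f, b (P f) f < - (c - e) * b f f.
  apply: contrapT => /forallNP nP.
  have : A (c - e) by split => [|f]; [lra | rewrite leNgt; exact/negP].
  by move=> /(ge_inf lbA); rewrite -/c; lra.
have bf : 0 < b f f.
  rewrite lt_def b0 andbT; apply/eqP => bf.
  by have := PM' f; move: Pf; rewrite bf !mulr0; lra.
(* Here [b (P f) (N f) = |S f|^2 - |T f|^2 >= 0], and [b f (N f) = 2 b (S f) f - b (P f) f >= (c -
   e) b f f]. *)
have QN : c * (c - e) * b f f <= b (Q f) (N f).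
  have : b f (N f) >= (c - e) * b f f.
    have := S0 f; move: Pf; rewrite /N /P !(psE psb) (psC psb f (T f)) (psC psb f (S f)); lra.
  move=> h; have : c * ((c - e) * b f f) <= c * b f (N f) by rewrite ler_pM2l.
  have := TS f; rewrite /Q /N /P !(psE psb) (psC psb (T f) (S f)); lra.
have QNQ : b (Q f) (N f) ^+ 2 <= (L * e * b f f) * (4 * K * b f f).
  apply: le_trans (ps_CauchySchwarz psb _ _) _.
  apply: ler_pM => //.
  apply: le_trans (QQ f) _; rewrite -mulrA ler_wpM2l//.
  by move: Pf; rewrite /Q (psDl psb (P f)) (psZl psb); lra.
have : (c * (c - e) * b f f) ^+ 2 <= (L * e * b f f) * (4 * K * b f f).
  apply: le_trans QNQ; rewrite ler_sqr ?nnegrE//.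
    by rewrite !mulr_ge0// ?ltW//; lra.
  by apply: le_trans QN; rewrite !mulr_ge0// ?ltW//; lra.
rewrite (_ : _ * _ = (4 * (K * L) * e) * (b f f) ^+ 2); last by ring.
rewrite exprMn ler_pM2r ?exprn_gt0// => h1.
have h2 : (c * (c / 2)) ^+ 2 <= (c * (c - e)) ^+ 2.
  have cc : 0 <= c * (c / 2) by rewrite mulr_ge0; lra.
  have le : c * (c / 2) <= c * (c - e) by rewrite ler_pM2l//; lra.
  by rewrite !expr2; apply: ler_pM.
have c4 : 0 < c ^+ 4 by rewrite exprn_gt0.
have h3 : (c * (c / 2)) ^+ 2 = c ^+ 4 / 4 by field.
by lra.
Qed.

(** [heinz] in both directions identifies the two quadratic forms, and polarization identifies the
    operators weakly. *)
Lemma pos_sqrt_unique b S S' : psform b -> symop b S -> symop b S' ->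
  bddop b S -> bddop b S' -> (forall f, 0 <= b (S f) f) ->
  (forall f, 0 <= b (S' f) f) -> (forall f, b (S f) (S f) = b (S' f) (S' f)) ->
  forall f g, b (S f) g = b (S' f) g.
Proof.
move=> psb sS sS' bS bS' S0 S'0 SS' f g.
have eqS h : b (S h) h = b (S' h) h.
  apply/eqP; rewrite eq_le; apply/andP; split.
    by apply: (heinz psb sS' sS bS') => // k; rewrite SS'.
  by apply: (heinz psb sS sS' bS) => // k; rewrite SS'.
have polar U : symop b U -> 2 * b (U f) g = b (U (f + g)) (f + g) - b (U f) f - b (U g) g.
  move=> sU; have -> : b (U g) g = b (U (f + g)) (f + g) - b (U f) f - 2 * b (U f) g.
    rewrite (sU (f + g)) (psDl psb f g) -!sU !(psDr psb) [b (U g) f]sU (psC psb g); lra.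
  lra.
by have := polar S sS; rewrite !eqS -polar//; lra.
Qed.

(** Completeness is asked only for sequences with geometrically decaying increments. This is what a
    contracting iteration produces, and it spares the extraction of a subsequence in the proof for
    [L^2]. *)
Definition ps_complete b :=
  forall (u : nat -> V) (C q : R), 0 <= q -> q < 1 ->
    (forall n, b (u n.+1 - u n) (u n.+1 - u n) <= C * q ^+ n) ->
  exists f, (fun n => b (u n - f) (u n - f)) @ \oo --> 0.

(* Richardson iteration [u (n+1) = u n + t (g - u n - P (u n))], contracting for small [t]. *)
Lemma id_add_pos_surj b P g : psform b -> ps_complete b -> symop b P ->
  bddop b P -> (forall f, 0 <= b (P f) f) ->
  exists f, b (g - (f + P f)) (g - (f + P f)) = 0.
Proof.
move=> psb cb sP bP P0.
have b0 := ps_ge0 psb.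
pose W f := f + P f.
have sW : symop b W by apply: symopD.
have [L L0 WL] : exists2 L, 0 <= L & forall f, b (W f) (W f) <= L * b f f.
  by apply: (bddop_ge0 psb); apply: (bddopD psb) => //; exact: bddop_id.
(* With this step [t^2 L <= t]. As [b (W h) h >= b h h], the squared norm of [h - t W h] is at most
   [(1 - 2 t + t^2 L) b h h <= (1 - t) b h h]. *)
pose t := (1 + L)^-1.
have t0 : 0 < t by rewrite invr_gt0; lra.
have tL : t * (1 + L) = 1 by rewrite mulVf//; lra.
have t1 : t <= 1 by nra.
pose e f := g - W f.
have WE f : W f = f + P f by [].
have eE f : e f = g - W f by [].
clearbody e W.
pose u := fix u n := if n is n'.+1 then u n' + t%:C *: e (u n') else 0.
have eS n : b (e (u n.+1)) (e (u n.+1)) <= (1 - t) * b (e (u n)) (e (u n)).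
  set f := u n.
  have -> : b (e (u n.+1)) (e (u n.+1)) =
      b (e f - t%:C *: W (e f)) (e f - t%:C *: W (e f)).
    (* [W] is linear only weakly, so the recursion for the residual holds after pairing; using it in
       each argument gives the equality of norms. *)
    have weak h : b (e (u n.+1)) h = b (e f - t%:C *: W (e f)) h.
      have eh : b (e f) h = b g h - b f (W h) by rewrite eE !(psE psb) sW.
      by rewrite /= -/f (eE (_ + _)) !(psE psb) !sW !(psE psb) eh; lra.
    by rewrite weak (psC psb) weak.
  rewrite !(psE psb) (psC psb (e f) (W _)).
  have := WL (e f).
  have : b (e f) (e f) <= b (W (e f)) (e f) by rewrite WE !(psE psb); have := P0 (e f); lra.
  move: (b0 (e f)); move: (b (e f) (e f)) (b (W (e f)) (e f)) (b (W (e f)) (W (e f))) => x y z x0 xy zx.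
  have : t * (t * z) <= t * (t * (L * x)) by rewrite !ler_pM2l.
  rewrite !mulrA.
  have : t * t * L * x <= t * x by rewrite ler_wpM2r//; nra.
  have : t * x <= t * y by rewrite ler_pM2l.
  nra.
have en n : b (e (u n)) (e (u n)) <= b (e 0) (e 0) * (1 - t) ^+ n.
  elim: n => [|n IH]; first by rewrite expr0 mulr1.
  apply: le_trans (eS n) _; rewrite exprS mulrCA ler_wpM2l//; lra.
have t10 : 0 <= 1 - t by lra.
have t11 : 1 - t < 1 by lra.
have [|f uf] := cb u (b (e 0) (e 0)) (1 - t) t10 t11.
  move=> n; rewrite /= addrAC subrr add0r !(psE psb).
  apply: le_trans (en n).
  by rewrite mulrA ler_piMl//; nra.
exists f; rewrite -WE -eE.
apply/eqP; rewrite eq_le b0 andbT.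
(* This bounds the residual of the limit for every [n], since weakly
   [e f = e (u n) + W (u n - f)]. *)
pose v n := 2 * (b (e 0) (e 0) * (1 - t) ^+ n) + 2 * (L * b (u n - f) (u n - f)).
have v0 : v @ \oo --> 0.
  have -> : 0 = 2 * (b (e 0) (e 0) * 0) + 2 * (L * 0) :> R by rewrite !mulr0 addr0.
  apply: cvgD; apply: cvgMr; apply: cvgMr => //.
  by apply: cvg_expr; rewrite ger0_norm.
rewrite -(cvg_lim _ v0)//; apply: limr_ge; first by apply/cvg_ex; exists 0.
apply: nearW => n; rewrite /v.
have -> : b (e f) (e f) = b (e (u n) + W (u n - f)) (e (u n) + W (u n - f)).
  have weak h : b (e f) h = b (e (u n) + W (u n - f)) h.
    by rewrite !eE !(psE psb) !sW !(psE psb); lra.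
  by rewrite weak (psC psb) weak.
apply: le_trans (ps_sqrD psb _ _) _.
by have := en n; have := WL (u n - f); lra.
Qed.

End SemiInner.

(** * Completeness of L^2 *)

Section SquareIntegrable.
Context d (T : measurableType d) (R : realType) (mu : {measure set T -> \bar R}).
Implicit Types f g : T -> R.

Definition sqint f :=
  measurable_fun setT f /\ mu.-integrable setT (fun x => (f x ^+ 2)%:E).

Lemma sqint_mul f g : sqint f -> sqint g ->
  mu.-integrable setT (EFin \o (fun x => f x * g x)).
Proof.
move=> [mf f2] [mg g2].
apply: (@le_integrable _ _ _ mu setT measurableT _
  (fun x => (f x ^+ 2)%:E + (g x ^+ 2)%:E)%E); last exact: integrableD.
  by apply/measurable_EFinP; exact: measurable_funM.
move=> x _; rewrite /= lee_fin (@ger0_norm _ (_ + _)) ?addr_ge0 ?sqr_ge0//.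
rewrite ler_norml; apply/andP; split.
  by have := sqr_ge0 (f x + g x); have := sqr_ge0 (f x); have := sqr_ge0 (g x); nra.
by have := sqr_ge0 (f x - g x); have := sqr_ge0 (f x); have := sqr_ge0 (g x); nra.
Qed.

Lemma sqintD f g : sqint f -> sqint g -> sqint (f \+ g).
Proof.
move=> sf sg; case: (sf) (sg) => mf f2 [mg g2]; split; first exact: measurable_funD.
apply: (@eq_integrable _ _ _ mu setT measurableT (fun x => ((f x ^+ 2)%:E + (g x ^+ 2)%:E
   + 2%:E * (f x * g x)%:E)%E)).
  by move=> x _; rewrite /= -EFinM -!EFinD; congr EFin; ring.
by apply: integrableD => //; [exact: integrableD|exact/integrableZl/sqint_mul].
Qed.

Lemma sqintZ (a : R) f : sqint f -> sqint (fun x => a * f x).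
Proof.
move=> [mf f2]; split; first exact: measurable_funM.
apply: (@eq_integrable _ _ _ mu setT measurableT (fun x => ((a ^+ 2)%:E * (f x ^+ 2)%:E)%E)).
  by move=> x _; rewrite -EFinM exprMn.
exact: integrableZl.
Qed.

Lemma sqintN f : sqint f -> sqint (fun x => - f x).
Proof.
by move=> /(sqintZ (-1)); congr sqint; apply/funext => x; rewrite mulN1r.
Qed.

(** Weighted Cauchy-Schwarz: the weights [rho ^+ k] with [k >= n] sum to [rho ^+ n / (1 - rho)]. *)
Lemma sqr_sum_geometric (rho : R) (a : nat -> R) n m : 0 < rho -> rho < 1 ->
  (\sum_(n <= k < n + m) a k) ^+ 2 <=
  rho ^+ n / (1 - rho) * \sum_(n <= k < n + m) rho ^- k * a k ^+ 2.
Proof.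
move=> rho0 rho1; elim: m n => [|m IH] n.
  by rewrite addn0 !big_geq// expr0n mulr0.
rewrite !(@big_ltn _ _ _ n) ?addnS ?ltnS ?leq_addr// -addSn.
have := IH n.+1; set x := a n; set y := \sum_(_ <= _ < _) a _; set z := \sum_(_ <= _ < _) _.
have := exprn_gt0 n rho0; rewrite (exprS rho); set t := rho ^+ n => t0 yz.
have r10 : 0 < 1 - rho by lra.
(* Splitting off the first term [x] from the rest [y]; the difference of the two sides is a square
   divided by [1 - rho]. *)
have h : rho * (x + y) ^+ 2 <= rho * (x ^+ 2 / (1 - rho)) + y ^+ 2.
  rewrite -subr_ge0.
  have -> : rho * (x ^+ 2 / (1 - rho)) + y ^+ 2 - rho * (x + y) ^+ 2 =
     (rho * x - (1 - rho) * y) ^+ 2 / (1 - rho) by field; lra.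
  by rewrite mulr_ge0 ?sqr_ge0 ?invr_ge0 ?ltW.
rewrite -(ler_pM2l rho0); apply: le_trans h _.
rewrite mulrDr mulrDr.
have -> : t / (1 - rho) * (t^-1 * x ^+ 2) = x ^+ 2 / (1 - rho).
  by field; rewrite !gt_eqF.
by rewrite lerD2l// !mulrA.
Qed.

(** Riesz-Fischer with a rate. For [q < rho < 1], squared increments weighted by [rho ^- n] still
    have a summable series of integrals, of ratio [q / rho]; where the weighted series is finite,
    the sequence converges pointwise. *)
Lemma sqint_complete (u : nat -> T -> R) (C q : R) : 0 <= q -> q < 1 ->
  (forall n, sqint (u n)) ->
  (forall n, \int[mu]_x ((u n.+1 x - u n x) ^+ 2) <= C * q ^+ n) ->
  exists2 v, sqint v &
    (fun n => \int[mu]_x ((u n x - v x) ^+ 2)) @ \oo --> 0.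
Proof.
move=> q0 q1 su uq.
pose rho : R := (1 + q) / 2.
have rho0 : 0 < rho by rewrite /rho; lra.
have rho1 : rho < 1 by rewrite /rho; lra.
have qrho : q < rho by rewrite /rho; lra.
have r10 : 0 < 1 - rho by lra.
clearbody rho.
pose a n x := u n.+1 x - u n x.
have sa n : sqint (a n) by exact: (sqintD (su _) (sqintN (su _))).
pose w n x := rho ^- n * a n x ^+ 2.
have w0 n x : 0 <= w n x by rewrite mulr_ge0 ?sqr_ge0 ?invr_ge0 ?exprn_ge0 ?ltW.
have iw n : mu.-integrable setT (EFin \o w n).
  apply: eq_integrable (integrableZl _ (rho ^- n) (proj2 (sa n))) => //.
(* [W] is integrable and dominates [(u n - v)^2] up to a geometric factor. *)
pose W x := (\sum_(n <oo) (w n x)%:E)%E.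
have W0 x : (0 <= W x)%E by apply: nneseries_ge0 => n _ _; rewrite lee_fin.
have mW : measurable_fun setT W.
  apply: (@ge0_emeasurable_sum _ _ _ _ (fun n x => (w n x)%:E) xpredT) => [k x _ _|k _].
    by rewrite lee_fin.
  exact: measurable_int (iw k).
have C0 : 0 <= C.
  have := uq 0%N; rewrite expr0 mulr1; apply: le_trans.
  by apply: Rintegral_ge0 => x _; exact: sqr_ge0.
have iW : mu.-integrable setT W.
  apply/integrableP; split => //.
  under eq_integral do rewrite gee0_abs//.
  rewrite integral_nneseries//; [|by move=> n; exact: measurable_int (iw n)|
     by move=> n x _; rewrite lee_fin].
  apply: (@le_lt_trans _ _ (C / (1 - q / rho))%:E); last exact: ltry.
  apply: lime_le.
    by apply: is_cvg_nneseries => n _ _; apply: integral_ge0 => x _; rewrite lee_fin.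
  apply: nearW => n.
  have qr0 : 0 <= q / rho by rewrite divr_ge0// ltW.
  have qr1 : q / rho < 1 by rewrite ltr_pdivrMr// mul1r.
  apply: (@le_trans _ _ (\sum_(0 <= k < n) (C * (q / rho) ^+ k)%:E)%E).
    apply: lee_sum => k _.
    rewrite -(fineK (integrable_fin_num _ (iw k)))// lee_fin.
    rewrite -[leLHS]/(\int[mu]_x (w k x)) RintegralZl//; last exact: (proj2 (sa k)).
    rewrite exprMn exprVn mulrA mulrC ler_pM2r ?invr_gt0 ?exprn_gt0//.
    exact: uq.
  rewrite sumEFin lee_fin -mulr_sumr ler_wpM2l//.
  have /(congr1 (fun f : nat -> R => f n)) := geometric_seriesE 1 (negbT (lt_eqF qr1)).
  rewrite seriesEnat/= mul1r => qn.
  rewrite (eq_bigr (fun k => 1 * (q / rho) ^+ k)) => [|k _]; last by rewrite mul1r.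
  rewrite qn ler_piMl ?invr_ge0 ?subr_ge0 ?(ltW qr1)//.
  by rewrite gerBl exprn_ge0.
(* Stated in the extended reals, so that it also covers the points where [W x = +oo]. *)
have CS x n m : (((u (n + m)%N x - u n x) ^+ 2)%:E <= (rho ^+ n / (1 - rho))%:E * W x)%E.
  have -> : u (n + m)%N x - u n x = \sum_(n <= k < n + m) a k x.
    by rewrite telescope_sumr ?leq_addr.
  apply: (@le_trans _ _ (rho ^+ n / (1 - rho) * \sum_(n <= k < n + m) w k x)%:E).
    by rewrite lee_fin; exact: sqr_sum_geometric.
  rewrite EFinM lee_pmul2l// ?fin_numE// ?lte_fin ?divr_gt0 ?exprn_gt0//.
  rewrite -sumEFin; apply: le_trans (@nneseries_lim_ge _ _ xpredT 0 (n + m) _).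
    rewrite (@big_cat_nat _ _ _ n 0 (n + m))//= ?leq_addr// leeDr//.
    by apply: sume_ge0 => k _; rewrite lee_fin.
  by move=> k _ _; rewrite lee_fin.
pose A := [set x | W x \is a fin_num].
have mA : measurable A.
  by have := emeasurable_fin_num measurableT mW; rewrite setTI.
(* Cutting off outside [A] makes the sequence converge everywhere, so that the limit [v] is
   measurable. *)
pose h n x := u n x * \1_A x.
pose v x := limn (fun n => h n x).
have mh n : measurable_fun setT (h n).
  by apply: measurable_funM; [exact: (proj1 (su n))|exact: measurable_indic].
have cvu x : A x -> cvgn (fun n => u n x).
  move=> Ax.
  have -> : (fun n => u n x) = (fun n => u 0%N x + series (a ^~ x) n).
    by apply/funext => n; exact: eq_sum_telescope.
  apply: is_cvgD; first exact: is_cvg_cst.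
  apply: normed_cvg.
  (* Absolute convergence: [y <= t + y^2 / t] with [t = rho ^+ n] and [y = |a n x|]. *)
  apply: (@series_le_cvg _ _ (fun n => rho ^+ n + w n x)) => [n|n|n|].
  - exact: normr_ge0.
  - by rewrite addr_ge0// exprn_ge0// ltW.
  - have := exprn_gt0 n rho0; rewrite /w; set t := rho ^+ n => t0.
    have : 0 <= (t - `|a n x|) ^+ 2 / t by rewrite mulr_ge0 ?sqr_ge0 ?invr_ge0 ?ltW.
    rewrite -(real_normK (num_real (a n x))); set y := `|a n x| => h1.
    have y0 : 0 <= y by exact: normr_ge0.
    have : (t - y) ^+ 2 / t = t + t^-1 * y ^+ 2 - 2 * y by field; rewrite gt_eqF.
    by move=> ?; change (y <= t + t^-1 * y ^+ 2); lra.
  - apply: is_cvg_seriesD.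
      have -> : GRing.exp rho = geometric 1 rho.
        by apply/funext => n; rewrite /geometric/= mul1r.
      by apply: is_cvg_geometric_series; rewrite gtr0_norm.
    apply: nondecreasing_is_cvgn.
      by apply/nondecreasing_seqP => n; rewrite seriesEnat/= big_nat_recr//= lerDl.
    exists (fine (W x)) => _ [n _ <-].
    rewrite -lee_fin fineK// -sumEFin.
    by apply: nneseries_lim_ge => k _ _; rewrite lee_fin.
have hv x : h ^~ x @ \oo --> v x.
  have [Ax|nAx] := pselect (A x).
    rewrite /v; have -> : h ^~ x = fun n => u n x.
      by apply/funext => n; rewrite /h indicE mem_set// mulr1.
    exact: cvu.
  rewrite /v; have -> : h ^~ x = fun n => 0.
    by apply/funext => n; rewrite /h indicE memNset// mulr0.
  exact: is_cvg_cst.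
have mv : measurable_fun setT v by exact: measurable_fun_cvg mh (fun x _ => hv x).
(* On [A], let [m] tend to infinity in [CS]; off [A] the right-hand side is [+oo]. *)
have uv n x : (((u n x - v x) ^+ 2)%:E <= (rho ^+ n / (1 - rho))%:E * W x)%E.
  have [Ax|nAx] := pselect (A x); last first.
    have -> : W x = +oo%E.
      by move: nAx (W0 x); rewrite /A/=; case: (W x).
    by rewrite gt0_muley ?leey// lte_fin divr_gt0// exprn_gt0.
  have cu : (fun m => (u (n + m)%N x - u n x) ^+ 2) @ \oo --> (v x - u n x) ^+ 2.
    have -> : (fun m => (u (n + m)%N x - u n x) ^+ 2) =
              (fun m => (h (m + n)%N x - u n x) ^+ 2).
      by apply/funext => m; rewrite /h indicE mem_set// mulr1 addnC.
    apply: cvgM; apply: cvgB; try exact: cvg_cst;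
    by rewrite (cvg_shiftn n (h ^~ x)).
  rewrite -sqrrN opprB -(cvg_lim _ cu)//.
  rewrite -(@fineK _ (W x))// -EFinM lee_fin.
  apply: limr_le; first by apply/cvg_ex; exists ((v x - u n x) ^+ 2).
  by apply: nearW => m; rewrite -lee_fin; apply: le_trans (CS x n m) _; rewrite (EFinM _ (fine _)) fineK.
have iuv n : mu.-integrable setT (fun x => ((u n x - v x) ^+ 2)%:E).
  apply: (@le_integrable _ _ _ mu setT measurableT _ (fun x => (rho ^+ n / (1 - rho))%:E * W x)%E).
  - apply/measurable_EFinP/measurable_funX/measurable_funB => //; exact: (proj1 (su n)).
  - move=> x _; rewrite gee0_abs ?lee_fin ?sqr_ge0//; apply: le_trans (uv n x) _.
    exact: lee_abs.
  - exact: integrableZl.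
have suv n : sqint (fun x => u n x - v x).
  split=> //; apply: measurable_funB => //; exact: (proj1 (su n)).
exists v.
  (* [v = u 0 - (u 0 - v)]. *)
  have := sqintD (su 0%N) (sqintN (suv 0%N)); congr sqint.
  by apply/funext => x /=; ring.
pose c := fine (\int[mu]_x W x)%E.
apply: (@squeeze_cvgr _ _ _ _ (fun=> 0) (fun n => c / (1 - rho) * rho ^+ n)).
- apply: nearW => n; apply/andP; split.
    by apply: Rintegral_ge0 => x _; exact: sqr_ge0.
  rewrite -lee_fin [leLHS]fineK ?integrable_fin_num//.
  apply: (@le_trans _ _ (\int[mu]_x ((rho ^+ n / (1 - rho))%:E * W x))%E).
    apply: le_integral => //; exact: integrableZl.
  rewrite integralZl// -(fineK (integrable_fin_num _ iW))// -/c -EFinM lee_fin.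
  by rewrite mulrC mulrAC mulrA.
- exact: cvg_cst.
- rewrite -(mulr0 (c / (1 - rho))); apply: cvgMr.
  by apply: cvg_expr; rewrite gtr0_norm.
Qed.
End SquareIntegrable.

(** * Unitary matrices *)

Section ComplexParts.
Context (R : realType).
Implicit Types z w : R[i].

Lemma Re_mulJ z w : complex.Re (z * w^*) = complex.Re z * complex.Re w + complex.Im z * complex.Im w.
Proof. by case: z w => a b [c d] /=; rewrite mulrN opprK. Qed.

Lemma Im_mulJ z w : complex.Im (z * w^*) = complex.Im z * complex.Re w - complex.Re z * complex.Im w.
Proof. by case: z w => a b [c d] /=; rewrite mulrN addrC (mulrC b). Qed.

Lemma Re_sum I (s : seq I) (P : pred I) (F : I -> R[i]) :
  complex.Re (\sum_(i <- s | P i) F i) = \sum_(i <- s | P i) complex.Re (F i).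
Proof. by apply: (big_morph (@complex.Re R)) => // -[a b] [c d]. Qed.

Lemma complex_ext z w : complex.Re z = complex.Re w -> complex.Im z = complex.Im w -> z = w.
Proof. by case: z w => a b [c d] /= -> ->. Qed.

End ComplexParts.

Section ConjTranspose.
Context (R : realType).

Lemma ctrE s r (A : 'M[R[i]]_(s, r)) : ctr A = (map_mx (@conjc R) A)^T.
Proof. by apply/matrixP => i j; rewrite !mxE. Qed.

Lemma ctrM s r t (A : 'M[R[i]]_(s, r)) (B : 'M[R[i]]_(r, t)) : ctr (A *m B) = ctr B *m ctr A.
Proof. by rewrite !ctrE map_mxM trmx_mul. Qed.

Lemma ctrK s r (A : 'M[R[i]]_(s, r)) : ctr (ctr A) = A.
Proof. by apply/matrixP => i j; rewrite !mxE conjcK. Qed.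

Lemma ctrD s r (A B : 'M[R[i]]_(s, r)) : ctr (A + B) = ctr A + ctr B.
Proof. by apply/matrixP => i j; rewrite !mxE rmorphD. Qed.

Lemma ctr_tr n (A : 'M[R[i]]_n) : \tr (ctr A) = (\tr A)^*.
Proof. by rewrite ctrE mxtrace_tr /mxtrace rmorph_sum; apply: eq_bigr => i _; rewrite mxE. Qed.

Lemma ctr_scalar n (a : R[i]) : ctr (a%:M : 'M[R[i]]_n) = (a^*)%:M.
Proof. by rewrite ctrE map_scalar_mx tr_scalar_mx. Qed.

Definition unitarymx n (A : 'M[R[i]]_n) := ctr A *m A = 1%:M /\ A *m ctr A = 1%:M.

Lemma unitarymx_ctr n (A : 'M[R[i]]_n) : unitarymx A -> unitarymx (ctr A).
Proof. by rewrite /unitarymx ctrK => -[]. Qed.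

Lemma unitarymx_perm n (p : 'S_n) : unitarymx (perm_mx p).
Proof.
rewrite /unitarymx ctrE map_perm_mx tr_perm_mx -!perm_mxM.
by rewrite mulVg mulgV perm_mx1.
Qed.

Lemma unitarymxM n (A B : 'M[R[i]]_n) : unitarymx A -> unitarymx B -> unitarymx (A *m B).
Proof.
move=> [A1 A2] [B1 B2]; split; rewrite ctrM mulmxA.
  by rewrite -(mulmxA _ _ A) A1 mulmx1.
by rewrite -(mulmxA _ B) B2 mulmx1.
Qed.

Lemma unitarymx_reflection n (k : 'I_n) :
  unitarymx (1%:M - 2 *: delta_mx k k : 'M[R[i]]_n).
Proof.
have kk : (2 *: delta_mx k k : 'M[R[i]]_n) *m (2 *: delta_mx k k) = 4 *: delta_mx k k.
  by rewrite -scalemxAl -scalemxAr mul_delta_mx scalerA -natrM.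
have ctrR : ctr (1%:M - 2 *: delta_mx k k : 'M[R[i]]_n) = 1%:M - 2 *: delta_mx k k.
  by rewrite ctrE map_mxB map_mx1 map_mxZ rmorph_nat map_delta_mx linearB/= trmx1 linearZ/= trmx_delta.
rewrite /unitarymx ctrR.
suff h : (1%:M - 2 *: delta_mx k k : 'M[R[i]]_n) *m (1%:M - 2 *: delta_mx k k) = 1%:M by [].
rewrite mulmxBl mul1mx mulmxBr mulmx1 kk (_ : 4 = 2 + 2) ?scalerDl; last by rewrite -natrD.
by rewrite opprB addrK subrK.
Qed.

Lemma mxtrace_delta_mul n (k : 'I_n) (X : 'M[R[i]]_n) : \tr (delta_mx k k *m X) = X k k.
Proof.
rewrite /mxtrace (bigD1 k)//= big1 ?addr0 => [|i ik].
  rewrite mxE (bigD1 k)//= big1 ?addr0 ?mxE ?eqxx ?mul1r// => j jk.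
  by rewrite mxE (negPf jk) andbF mul0r.
by rewrite mxE big1// => j _; rewrite mxE (negPf ik) mul0r.
Qed.

(** Dual form of the fact that unitary matrices span all matrices. With [p] the matrix of the
    transposition of [k] and [i], both [p] and [(1 - 2 delta_mx k k) p] are unitary; the traces
    differ by [2 \tr (delta_mx k k *m p *m X)], which is twice the entry of [X] at [(i, k)]. *)
Lemma unitary_trace_eq0 n (X : 'M[R[i]]_n) :
  (forall A, unitarymx A -> \tr (A *m X) = 0) -> X = 0.
Proof.
move=> X0; apply/matrixP => i k; rewrite [RHS]mxE.
pose p := perm_mx (tperm k i) : 'M[R[i]]_n.
have pu : unitarymx p by exact: unitarymx_perm.
have := X0 _ (unitarymxM (unitarymx_reflection k) pu).
rewrite mulmxBl mul1mx mulmxBl linearB/= X0// sub0r -!scalemxAl linearZ/=.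
rewrite -mulmxA mxtrace_delta_mul -row_permE mxE tpermL => /eqP.
by rewrite oppr_eq0 mulf_eq0 pnatr_eq0/= => /eqP.
Qed.

End ConjTranspose.

(** * The matrix-valued inner product *)

Section ComplexIntegral.
Context (R : realType) (G : topologicalZmodType)
  (mu : {measure set (borelType G) -> \bar R}).
Implicit Types h k : borelType G -> R[i].

Definition cintegrable h :=
  mu.-integrable setT (EFin \o (fun x => complex.Re (h x))) /\
  mu.-integrable setT (EFin \o (fun x => complex.Im (h x))).

Lemma cintegrableD h k : cintegrable h -> cintegrable k ->
  cintegrable (fun x => h x + k x).
Proof.
move=> [hr hi] [kr ki]; split.
  by apply: eq_integrable (integrableD _ hr kr) => // x _ /=; case: (h x) (k x) => ? ? [].
by apply: eq_integrable (integrableD _ hi ki) => // x _ /=; case: (h x) (k x) => ? ? [].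
Qed.

Lemma cintD h k : cintegrable h -> cintegrable k ->
  cint mu (fun x => h x + k x) = cint mu h + cint mu k.
Proof.
move=> [hr hi] [kr ki]; apply: complex_ext => /=; rewrite -RintegralD//;
by apply: eq_Rintegral => x _; case: (h x) (k x) => ? ? [].
Qed.

Lemma cintegrableZ (a : R[i]) h : cintegrable h -> cintegrable (fun x => a * h x).
Proof.
case: a => a b [hr hi]; split.
  apply: eq_integrable (integrableB _ (integrableZl _ a hr) (integrableZl _ b hi)) => //.
  by move=> x _ /=; case: (h x).
apply: eq_integrable (integrableD _ (integrableZl _ a hi) (integrableZl _ b hr)) => //.
by move=> x _ /=; case: (h x).
Qed.

Lemma cintZ (a : R[i]) h : cintegrable h -> cint mu (fun x => a * h x) = a * cint mu h.
Proof.
case: a => a b [hr hi]; apply: complex_ext => /=.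
  rewrite -!RintegralZl// -RintegralB//; try exact: (integrableZl _ _ hr); try exact: (integrableZl _ _ hi).
  by apply: eq_Rintegral => x _; case: (h x).
rewrite -!RintegralZl// -RintegralD//; try exact: (integrableZl _ _ hr); try exact: (integrableZl _ _ hi).
by apply: eq_Rintegral => x _; case: (h x).
Qed.

Lemma cint0 : cint mu (fun=> 0) = 0.
Proof. by rewrite /cint/= !Rintegral_cst// !mul0r. Qed.

Lemma cintegrable0 : cintegrable (fun=> 0).
Proof. by split; exact: integrable0. Qed.

Lemma cintegrable_sum (I : Type) (s : seq I) (F : I -> borelType G -> R[i]) :
  (forall i, cintegrable (F i)) -> cintegrable (fun x => \sum_(i <- s) F i x).
Proof.
move=> iF; elim: s => [|i s IH].
  by under eq_fun do rewrite big_nil; exact: cintegrable0.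
by under eq_fun do rewrite big_cons; exact: cintegrableD.
Qed.

Lemma cint_sum (I : Type) (s : seq I) (F : I -> borelType G -> R[i]) :
  (forall i, cintegrable (F i)) ->
  cint mu (fun x => \sum_(i <- s) F i x) = \sum_(i <- s) cint mu (F i).
Proof.
move=> iF; elim: s => [|i s IH].
  by under eq_fun do rewrite big_nil; rewrite big_nil cint0.
under eq_fun do rewrite big_cons.
by rewrite cintD// ?big_cons ?IH//; exact: cintegrable_sum.
Qed.

Lemma cint_conj h : cintegrable h -> cint mu (fun x => (h x)^*) = (cint mu h)^*.
Proof.
move=> [hr hi]; apply: complex_ext => /=.
  by apply: eq_Rintegral => x _; case: (h x).
rewrite -mulN1r -RintegralZl//.
by apply: eq_Rintegral => x _; rewrite mulN1r; case: (h x).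
Qed.

End ComplexIntegral.

Section MatrixInner.
Context (R : realType) (G : topologicalZmodType)
  (mu : {measure set (borelType G) -> \bar R}) (s r : nat).
Notation Fn := (borelType G -> 'M[R[i]]_(s, r)).
Implicit Types f g h : Fn.

Lemma L2P f : L2 mu f <-> forall i j,
  sqint mu (fun x => complex.Re (f x i j)) /\ sqint mu (fun x => complex.Im (f x i j)).
Proof.
split=> [f2 i j|f2 i j].
  have [mr mi ii] := f2 i j; split; split => //.
    apply: (le_integrable measurableT _ _ ii).
      exact/measurable_EFinP/measurable_funX.
    by move=> x _ /=; rewrite lee_fin !ger0_norm ?addr_ge0 ?sqr_ge0// lerDl sqr_ge0.
  apply: (le_integrable measurableT _ _ ii).
    exact/measurable_EFinP/measurable_funX.
  by move=> x _ /=; rewrite lee_fin !ger0_norm ?addr_ge0 ?sqr_ge0// lerDr sqr_ge0.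
by have [[mr ir] [mi ii]] := f2 i j; split => //; exact: (integrableD _ ir ii).
Qed.

Lemma L2D f g : L2 mu f -> L2 mu g -> L2 mu (f + g).
Proof.
move=> /L2P f2 /L2P g2; apply/L2P => i j.
have [fr fi] := f2 i j; have [gr gi] := g2 i j; split.
  have := sqintD fr gr; congr sqint; apply/funext => x /=; rewrite ?fctE mxE.
  by case: (f x i j) (g x i j) => ? ? [].
have := sqintD fi gi; congr sqint; apply/funext => x /=; rewrite ?fctE mxE.
by case: (f x i j) (g x i j) => ? ? [].
Qed.

Lemma L2_0 : L2 mu (0 : Fn).
Proof.
apply/L2P => i j; split; split; rewrite /=; under eq_fun do rewrite /= ?fctE mxE/=.
- exact: measurable_cst.
- by rewrite expr0n; exact: integrable0.
- exact: measurable_cst.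
- by rewrite expr0n; exact: integrable0.
Qed.

Lemma sqint0 : sqint mu (fun=> 0).
Proof. by split; [exact: measurable_cst|rewrite expr0n; exact: integrable0]. Qed.

Lemma L2M (A : 'M[R[i]]_s) f : L2 mu f -> L2 mu (fun x => A *m f x).
Proof.
move=> /L2P f2; apply/L2P => i j.
pose P (F : borelType G -> R[i]) := sqint mu (fun x => complex.Re (F x)) /\ sqint mu (fun x => complex.Im (F x)).
rewrite -/(P (fun x => (A *m f x) i j)).
have -> : (fun x => (A *m f x) i j) = fun x => \sum_(k < s) A i k * f x k j.
  by apply/funext => x; rewrite mxE.
elim: (index_enum _) => [|k l [IH1 IH2]].
  by under eq_fun do rewrite big_nil; split; exact: sqint0.
under eq_fun do rewrite big_cons.
have [fr fi] := f2 k j; case: (A i k) => a b.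
split.
  have := sqintD (sqintD (sqintZ a fr) (sqintN (sqintZ b fi))) IH1.
  by congr sqint; apply/funext => x /=; case: (f x k j) (\sum_(_ <- _) _) => ? ? [].
have := sqintD (sqintD (sqintZ a fi) (sqintZ b fr)) IH2.
by congr sqint; apply/funext => x /=; case: (f x k j) (\sum_(_ <- _) _) => ? ? [].
Qed.

Lemma L2Z (a : R[i]) f : L2 mu f -> L2 mu (a *: f).
Proof.
move=> /(L2M a%:M); congr L2; apply/funext => x; by rewrite mul_scalar_mx.
Qed.

Lemma L2N f : L2 mu f -> L2 mu (- f).
Proof. by move=> /(L2Z (-1)); rewrite scaleN1r. Qed.

Lemma L2B f g : L2 mu f -> L2 mu g -> L2 mu (f - g).
Proof. by move=> f2 g2; apply: L2D => //; exact: L2N. Qed.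

Lemma cintegrable_mulJ f g i j k l : L2 mu f -> L2 mu g ->
  cintegrable mu (fun x => f x i j * (g x k l)^*).
Proof.
move=> /L2P f2 /L2P g2.
have [fr fi] := f2 i j; have [gr gi] := g2 k l; split.
  apply: eq_integrable (integrableD _ (sqint_mul fr gr) (sqint_mul fi gi)) => //.
  by move=> x _ /=; rewrite Re_mulJ.
apply: eq_integrable (integrableB _ (sqint_mul fi gr) (sqint_mul fr gi)) => //.
by move=> x _ /=; rewrite Im_mulJ.
Qed.

Lemma cintegrable_mip f g i j : L2 mu f -> L2 mu g ->
  cintegrable mu (fun x => (f x *m ctr (g x)) i j).
Proof.
move=> f2 g2; under eq_fun do rewrite mxE.
by apply: cintegrable_sum => k; under eq_fun do rewrite mxE; exact: cintegrable_mulJ.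
Qed.

Fact minner_key : unit. Proof. by []. Qed.

(* The matrix-valued inner product, locked so that unification never unfolds the integrals. *)
Definition minner : Fn -> Fn -> 'M[R[i]]_s := locked_with minner_key (@mip R G mu s r).

Lemma minnerE f g : minner f g = mip mu f g.
Proof. by rewrite /minner unlock. Qed.

Lemma minnerDl f g h : L2 mu f -> L2 mu g -> L2 mu h ->
  minner (f + g) h = minner f h + minner g h.
Proof.
move=> f2 g2 h2; rewrite !minnerE; apply/matrixP => i j; rewrite !mxE -cintD; try exact: cintegrable_mip.
by congr cint; apply/funext => x; rewrite ?fctE mulmxDl mxE.
Qed.

Lemma minnerMl (A : 'M[R[i]]_s) f g : L2 mu f -> L2 mu g ->
  minner (fun x => A *m f x) g = A *m minner f g.
Proof.
move=> f2 g2; rewrite !minnerE; apply/matrixP => i j; rewrite !mxE.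
rewrite (eq_bigr (fun k => cint mu (fun x => A i k * (f x *m ctr (g x)) k j)));
  last by move=> k _; rewrite mxE cintZ//; exact: cintegrable_mip.
rewrite -cint_sum => [|k]; last by apply: cintegrableZ; exact: cintegrable_mip.
by congr cint; apply/funext => x; rewrite -mulmxA mxE.
Qed.

Lemma minnerZl (a : R[i]) f g : L2 mu f -> L2 mu g -> minner (a *: f) g = a *: minner f g.
Proof.
move=> f2 g2; have -> : a *: f = fun x => a%:M *m f x.
  by apply/funext => x; rewrite mul_scalar_mx.
by rewrite minnerMl// mul_scalar_mx.
Qed.

Lemma minnerC f g : L2 mu f -> L2 mu g -> minner g f = ctr (minner f g).
Proof.
move=> f2 g2; rewrite !minnerE; apply/matrixP => i j; rewrite !mxE -cint_conj; last exact: cintegrable_mip.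
congr cint; apply/funext => x.
have -> : g x *m ctr (f x) = ctr (f x *m ctr (g x)) by rewrite ctrM ctrK.
by rewrite mxE.
Qed.

Lemma minnerDr f g h : L2 mu f -> L2 mu g -> L2 mu h ->
  minner h (f + g) = minner h f + minner h g.
Proof.
move=> f2 g2 h2; have fg2 := L2D f2 g2.
by rewrite (minnerC fg2 h2) (minnerC f2 h2) (minnerC g2 h2) minnerDl// ctrD.
Qed.

Lemma minnerMr (A : 'M[R[i]]_s) f g : L2 mu f -> L2 mu g ->
  minner f (fun x => A *m g x) = minner f g *m ctr A.
Proof.
move=> f2 g2; have Ag2 := L2M A g2.
by rewrite (minnerC Ag2 f2) (minnerC g2 f2) minnerMl// ctrM.
Qed.

Lemma minnerZr (a : R[i]) f g : L2 mu f -> L2 mu g -> minner f (a *: g) = a^* *: minner f g.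
Proof.
move=> f2 g2; have -> : a *: g = fun x => a%:M *m g x.
  by apply/funext => x; rewrite mul_scalar_mx.
by rewrite minnerMr// ctr_scalar mul_mx_scalar.
Qed.

Definition tinner f g : R[i] := \tr (minner f g).

Lemma ipE f g : ip mu f g = tinner f g.
Proof. by rewrite /tinner minnerE. Qed.

Lemma tinnerMl (A : 'M[R[i]]_s) f g : L2 mu f -> L2 mu g ->
  tinner (fun x => A *m f x) g = tinner f (fun x => ctr A *m g x).
Proof. by move=> f2 g2; rewrite /tinner minnerMl// minnerMr// ctrK mxtrace_mulC. Qed.

(** The real form to which the abstract results apply; [tinner_of_rip] and [minner_of_rip] recover
    the complex and matrix-valued information. *)
Definition rip f g := complex.Re (tinner f g).

Lemma ripC f g : L2 mu f -> L2 mu g -> rip f g = rip g f.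
Proof. by move=> f2 g2; rewrite /rip /tinner (minnerC f2 g2) ctr_tr; case: (\tr _). Qed.

Lemma ripDl f g h : L2 mu f -> L2 mu g -> L2 mu h ->
  rip (f + g) h = rip f h + rip g h.
Proof.
move=> f2 g2 h2; rewrite /rip /tinner minnerDl// mxtraceD.
by case: (\tr _) (\tr _) => ? ? [].
Qed.

Lemma ripZl (a : R) f g : L2 mu f -> L2 mu g -> rip (a%:C *: f) g = a * rip f g.
Proof.
move=> f2 g2; rewrite /rip /tinner minnerZl// mxtraceZ.
by case: (\tr _) => ? ?; rewrite /= mul0r subr0.
Qed.

Lemma ripNl f g : L2 mu f -> L2 mu g -> rip (- f) g = - rip f g.
Proof.
by move=> f2 g2; rewrite -[- f]scaleN1r -[-1](rmorphN1 (real_complex R)) ripZl// mulN1r.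
Qed.

Lemma ripBl f g h : L2 mu f -> L2 mu g -> L2 mu h ->
  rip (f - g) h = rip f h - rip g h.
Proof. by move=> f2 g2 h2; rewrite ripDl ?ripNl//; exact: L2N. Qed.

Lemma nsqE f : nsq mu f = rip f f.
Proof. by rewrite /nsq ipE. Qed.

(** Reduces positivity and completeness to real scalar functions, entry by entry. *)
Lemma rip_sum f : L2 mu f -> rip f f = \sum_(i < s) \sum_(j < r)
  (\int[mu]_x (complex.Re (f x i j) ^+ 2) + \int[mu]_x (complex.Im (f x i j) ^+ 2)).
Proof.
move=> f2; rewrite /rip /tinner minnerE /mxtrace Re_sum; apply: eq_bigr => i _.
rewrite mxE (_ : (fun x => _) = fun x => \sum_(j < r) f x i j * (f x i j)^*); last first.
  by apply/funext => x; rewrite mxE; apply: eq_bigr => j _; rewrite mxE.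
rewrite cint_sum => [|j]; last exact: cintegrable_mulJ.
rewrite Re_sum; apply: eq_bigr => j _ /=.
have [[_ fr] [_ fi]] := proj1 (L2P f) f2 i j.
by rewrite -RintegralD//; apply: eq_Rintegral => x _; rewrite Re_mulJ !expr2.
Qed.

Lemma rip_ge0 f : L2 mu f -> 0 <= rip f f.
Proof.
move=> f2; rewrite rip_sum//; do 2![apply: sumr_ge0 => ? _].
by rewrite addr_ge0// Rintegral_ge0// => x _; exact: sqr_ge0.
Qed.

End MatrixInner.

Lemma cvg_sumr (R : realType) (I : Type) (l : seq I) (f : I -> nat -> R) (a : I -> R) :
  (forall i, f i @ \oo --> a i) ->
  (fun n => \sum_(i <- l) f i n) @ \oo --> \sum_(i <- l) a i.
Proof.
move=> fa; elim: l => [|i l IH].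
  by under eq_fun do rewrite big_nil; rewrite big_nil; exact: cvg_cst.
by under eq_fun do rewrite big_cons; rewrite big_cons; exact: cvgD.
Qed.

(** * Square-integrable functions as a complete semi-inner product space *)

Section L2Type.
Context (R : realType) (G : topologicalZmodType)
  (mu : {measure set (borelType G) -> \bar R}) (s r : nat).
Notation Fn := (borelType G -> 'M[R[i]]_(s, r)).

Definition L2pred : {pred Fn} := fun f => `[< L2 mu f >].

Lemma L2pred_submod_closed : submod_closed L2pred.
Proof.
split=> [|a f g /asboolP f2 /asboolP g2]; apply/asboolP; first exact: L2_0.
by apply: L2D => //; exact: L2Z.
Qed.

HB.instance Definition _ := GRing.isSubmodClosed.Build R[i] Fn L2pred L2pred_submod_closed.

(** Bundled because the abstract results need a module on which the form is defined everywhere; a.e.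
    equal functions remain distinct elements. *)
Record L2type := MkL2 { L2fun :> Fn; _ : L2fun \in L2pred }.
HB.instance Definition _ := [isSub for L2fun].
HB.instance Definition _ := [Choice of L2type by <:].
HB.instance Definition _ := [SubChoice_isSubLmodule of L2type by <:].

Lemma L2funP (f : L2type) : L2 mu f.
Proof. by apply/asboolP; exact: valP f. Qed.

Definition toL2 (f : Fn) (f2 : L2 mu f) : L2type := MkL2 (asboolT f2 : f \in L2pred).

Definition L2rip (f g : L2type) : R := rip mu f g.

Lemma psform_L2rip : psform L2rip.
Proof.
split=> [f g|f g h|a f h|f].
- exact: ripC (L2funP f) (L2funP g).
- exact: ripDl (L2funP f) (L2funP g) (L2funP h).
- exact: ripZl (L2funP f) (L2funP h).
- exact: rip_ge0 (L2funP f).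
Qed.

Lemma L2rip_complete : ps_complete L2rip.
Proof.
move=> u C q q0 q1 uq.
pose d n : Fn := L2fun (u n.+1) - L2fun (u n).
have d2 n : L2 mu (d n) by apply: L2B; exact: L2funP.
have nd n : rip mu (d n) (d n) <= C * q ^+ n by exact: uq.
(* Each entry contributes one nonnegative term to [rip_sum], so its real and imaginary parts inherit
   the geometric bound. *)
have term_le n i j :
    \int[mu]_x (complex.Re (d n x i j) ^+ 2) + \int[mu]_x (complex.Im (d n x i j) ^+ 2)
    <= C * q ^+ n.
  apply: le_trans (nd n); rewrite rip_sum//.
  rewrite (bigD1 i)//= (bigD1 j)//= -addrA lerDl addr_ge0 ?sumr_ge0//.
    move=> k _; rewrite addr_ge0// Rintegral_ge0// => x _; exact: sqr_ge0.
  move=> k _; apply: sumr_ge0 => l _.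
  by rewrite addr_ge0// Rintegral_ge0// => x _; exact: sqr_ge0.
have ge0Re n i j : 0 <= \int[mu]_x (complex.Re (d n x i j) ^+ 2).
  by apply: Rintegral_ge0 => x _; exact: sqr_ge0.
have ge0Im n i j : 0 <= \int[mu]_x (complex.Im (d n x i j) ^+ 2).
  by apply: Rintegral_ge0 => x _; exact: sqr_ge0.
have ReB (f g : Fn) x i j : complex.Re ((f - g) x i j) = complex.Re (f x i j) - complex.Re (g x i j).
  by rewrite !mxE; case: (f x i j) (g x i j) => ? ? [].
have ImB (f g : Fn) x i j : complex.Im ((f - g) x i j) = complex.Im (f x i j) - complex.Im (g x i j).
  by rewrite !mxE; case: (f x i j) (g x i j) => ? ? [].
have /choice[a aP] (p : 'I_s * 'I_r) : exists v : borelType G -> R, sqint mu v /\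
    (fun n => \int[mu]_x ((complex.Re (u n x p.1 p.2) - v x) ^+ 2)) @ \oo --> 0.
  have [n|n|v v2 uv] := @sqint_complete _ _ _ mu (fun n x => complex.Re (u n x p.1 p.2)) C q q0 q1.
  - exact: (proj1 (proj1 (L2P mu _) (L2funP (u n)) p.1 p.2)).
  - apply: le_trans (term_le n p.1 p.2); under eq_Rintegral do rewrite -ReB.
    by rewrite lerDl.
  - by exists v.
have /choice[b bP] (p : 'I_s * 'I_r) : exists v : borelType G -> R, sqint mu v /\
    (fun n => \int[mu]_x ((complex.Im (u n x p.1 p.2) - v x) ^+ 2)) @ \oo --> 0.
  have [n|n|v v2 uv] := @sqint_complete _ _ _ mu (fun n x => complex.Im (u n x p.1 p.2)) C q q0 q1.
  - exact: (proj2 (proj1 (L2P mu _) (L2funP (u n)) p.1 p.2)).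
  - apply: le_trans (term_le n p.1 p.2); under eq_Rintegral do rewrite -ImB.
    by rewrite lerDr.
  - by exists v.
pose v : Fn := fun x => \matrix_(i, j) (a (i, j) x +i* b (i, j) x).
have v2 : L2 mu v.
  apply/L2P => i j; split.
    by have := proj1 (aP (i, j)); congr sqint; apply/funext => x; rewrite mxE.
  by have := proj1 (bP (i, j)); congr sqint; apply/funext => x; rewrite mxE.
exists (toL2 v2).
have -> : (fun n => L2rip (u n - toL2 v2) (u n - toL2 v2)) = (fun n => \sum_(i < s) \sum_(j < r)
   (\int[mu]_x ((complex.Re (u n x i j) - a (i, j) x) ^+ 2) +
    \int[mu]_x ((complex.Im (u n x i j) - b (i, j) x) ^+ 2))).
  apply/funext => n; rewrite /L2rip rip_sum; last exact: L2funP.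
  apply: eq_bigr => i _; apply: eq_bigr => j _.
  by congr (_ + _); apply: eq_Rintegral => x _; rewrite (ReB, ImB) /= mxE.
rewrite [X in _ --> X](_ : _ = \sum_(i < s) \sum_(j < r) (0 + 0)); last first.
  by rewrite big1// => i _; rewrite big1// => j _; rewrite addr0.
apply: cvg_sumr => i; apply: cvg_sumr => j.
by apply: cvgD; [exact: (proj2 (aP (i, j)))|exact: (proj2 (bP (i, j)))].
Qed.

End L2Type.

(** * Operators symmetric for the matrix-valued inner product *)

Section Operators.
Context (R : realType) (G : topologicalZmodType)
  (mu : {measure set (borelType G) -> \bar R}) (s r : nat).
Notation Fn := (borelType G -> 'M[R[i]]_(s, r)).
Notation Op := (Fn -> Fn).
Implicit Types (f g h : Fn) (U S T P : Op).

(** The trace inner product is conjugate linear on the right, so its imaginary part at [h] is its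
    real part at ['i *: h]. *)
Lemma tinner_of_rip f g : L2 mu f -> L2 mu g ->
  (forall h, L2 mu h -> rip mu f h = rip mu g h) ->
  forall h, L2 mu h -> tinner mu f h = tinner mu g h.
Proof.
move=> f2 g2 fg h h2; apply: complex_ext; first exact: fg.
have Im_rip k : L2 mu k -> complex.Im (tinner mu k h) = rip mu k ('i *: h).
  by move=> k2; rewrite /rip /tinner minnerZr// mxtraceZ; case: (\tr _) => a b /=; ring.
by rewrite !Im_rip// fg//; exact: L2Z.
Qed.

(** Testing against [ctr A *m h] instead of [h] gives equality of the traces of [A] times either
    matrix, for every [A]. *)
Lemma minner_of_rip f g : L2 mu f -> L2 mu g ->
  (forall h, L2 mu h -> rip mu f h = rip mu g h) ->
  forall h, L2 mu h -> minner mu f h = minner mu g h.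
Proof.
move=> f2 g2 /(tinner_of_rip f2 g2) fg h h2.
apply/subr0_eq/unitary_trace_eq0 => A _.
rewrite mulmxBr linearB/= -!minnerMl// -!/(tinner mu _ _).
by rewrite !tinnerMl// fg ?subrr//; exact: L2M.
Qed.

Lemma hadjoint_tinner U S f g : is_hadjoint mu U S -> L2 mu f -> L2 mu g ->
  tinner mu (U f) g = tinner mu f (S g).
Proof. by move=> US f2 g2; rewrite -!ipE; exact: US. Qed.

Lemma aeqE f g : aeq mu f g <-> rip mu (f - g) (f - g) = 0.
Proof. by rewrite /aeq nsqE. Qed.

Lemma aeq_of_rip f g : L2 mu f -> L2 mu g ->
  (forall h, L2 mu h -> rip mu f h = rip mu g h) -> aeq mu f g.
Proof.
move=> f2 g2 fg; have fg2 := L2B f2 g2.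
by apply/aeqE; rewrite ripBl// fg// subrr.
Qed.

Lemma rip_aeq f g h : L2 mu f -> L2 mu g -> aeq mu f g -> L2 mu h ->
  rip mu f h = rip mu g h.
Proof.
move=> f2 g2 /aeqE d0 h2; apply: subr0_eq; rewrite -ripBl//.
exact: (@ps_null _ _ _ (psform_L2rip mu s r) (toL2 (L2B f2 g2)) (toL2 h2) d0).
Qed.

Lemma minner_aeq f g h : L2 mu f -> L2 mu g -> aeq mu f g -> L2 mu h ->
  minner mu f h = minner mu g h.
Proof. by move=> f2 g2 fg; apply: minner_of_rip => // k; exact: rip_aeq. Qed.

Definition mx_sym U := forall f g, L2 mu f -> L2 mu g -> minner mu (U f) g = minner mu f (U g).

(** Linearity and compatibility with a.e. equality are left out: [bounded_mx_sym_blop] derives them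
    from symmetry by moving [U] to the other argument. *)
Definition bounded_mx_sym U :=
  [/\ forall f, L2 mu f -> L2 mu (U f),
      exists K : R, forall f, L2 mu f -> rip mu (U f) (U f) <= K * rip mu f f & mx_sym U].

Lemma bounded_mx_symD S T : bounded_mx_sym S -> bounded_mx_sym T ->
  bounded_mx_sym (fun f => S f + T f).
Proof.
move=> [S2 [K SK] sS] [T2 [L TL] sT]; split.
- by move=> f f2; apply: L2D; [exact: S2|exact: T2].
- exists (2 * K + 2 * L) => f f2.
  have := ps_sqrD (psform_L2rip mu s r) (toL2 (S2 _ f2)) (toL2 (T2 _ f2)).
  rewrite /L2rip/= => h; apply: le_trans h _.
  by have := SK f f2; have := TL f f2; lra.
- move=> f g f2 g2; have Sf2 := S2 f f2; have Tf2 := T2 f f2.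
  have Sg2 := S2 g g2; have Tg2 := T2 g g2.
  by rewrite minnerDl// minnerDr// sS// sT.
Qed.

Lemma bounded_mx_symZ (a : R) S : bounded_mx_sym S ->
  bounded_mx_sym (fun f => a%:C *: S f).
Proof.
move=> [S2 [K SK] sS]; split.
- by move=> f f2; apply: L2Z; exact: S2.
- exists (a ^+ 2 * K) => f f2.
  have Sf2 := S2 f f2; have aSf2 := L2Z a%:C Sf2.
  rewrite ripZl// (ripC Sf2)// ripZl//.
  by rewrite mulrA -expr2 -mulrA ler_wpM2l ?sqr_ge0//; exact: SK.
- move=> f g f2 g2; have Sf2 := S2 f f2; have Sg2 := S2 g g2.
  rewrite minnerZl// minnerZr// sS//; congr (_ *: _).
  by apply/esym; exact: conjc_real.
Qed.

Lemma bounded_mx_symN S : bounded_mx_sym S -> bounded_mx_sym (fun f => - S f).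
Proof.
move=> /(bounded_mx_symZ (-1)); congr bounded_mx_sym; apply/funext => f.
by rewrite [X in X *: _](rmorphN1 (real_complex R)) scaleN1r.
Qed.

Lemma bounded_mx_sym_id : bounded_mx_sym id.
Proof. by split => //; exists 1 => f _; rewrite mul1r. Qed.

Lemma mx_sym_selfadjoint U : mx_sym U -> selfadjoint mu U.
Proof. by move=> sU f g f2 g2; rewrite !ipE /tinner sU. Qed.

Lemma bounded_mx_sym_blop U : bounded_mx_sym U -> blop mu U.
Proof.
move=> [U2 [K UK] sU]; split.
- exact: U2.
- move=> f g f2 g2 fg; have Uf2 := U2 f f2; have Ug2 := U2 g g2.
  apply: aeq_of_rip => // h h2; have Uh2 := U2 h h2.
  by rewrite /rip /tinner !sU// (minner_aeq f2 g2 fg).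
- move=> a f g f2 g2; have af2 := L2Z a f2.
  apply: (@aeq_of_rip (U (a *: f + g)) (a *: U f + U g)).
  + by apply: U2; exact: L2D.
  + by apply: L2D; [apply: L2Z|]; exact: U2.
  + move=> h h2; have Uh2 := U2 h h2; have Uf2 := U2 f f2; have Ug2 := U2 g g2.
    have aUf2 := L2Z a Uf2; have afg2 := L2D af2 g2.
    by rewrite /rip /tinner sU// !minnerDl// !minnerZl// !sU.
- by exists K => f f2; rewrite !nsqE; exact: UK.
Qed.

Lemma bounded_mx_sym_adjointable U : bounded_mx_sym U -> mx_adjointable mu U.
Proof.
move=> bU; have [_ _ sU] := bU; exists U; split.
- exact: bounded_mx_sym_blop.
- exact: mx_sym_selfadjoint.
- by move=> f g f2 g2; rewrite -!minnerE sU.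
Qed.

(** The matrix-valued adjoint [V] is also an adjoint for the trace, as [T] is, so [V g] and [T g]
    agree weakly; [minner_of_rip] lifts this to the matrix-valued product. *)
Lemma selfadjoint_mx_sym T : blop mu T -> selfadjoint mu T -> mx_adjointable mu T ->
  bounded_mx_sym T.
Proof.
move=> [T2 _ _ [K TK]] aT [V [[V2 _ _ _] hV mV]]; split => //.
  by exists K => f f2; rewrite -!nsqE; exact: TK.
move=> f g f2 g2; have Vg2 := V2 g g2; have Tg2 := T2 g g2.
rewrite minnerE mV// -minnerE (minnerC Vg2 f2) (minnerC Tg2 f2); congr ctr.
apply: minner_of_rip => // h h2.
rewrite ripC// (ripC Tg2)// /rip -(hadjoint_tinner hV)//.
by rewrite (hadjoint_tinner aT).
Qed.

Definition liftL2 U (U2 : forall f, L2 mu f -> L2 mu (U f)) (f : L2type mu s r) : L2type mu s r :=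
  toL2 (U2 f (L2funP f)).

Lemma symop_liftL2 U (U2 : forall f, L2 mu f -> L2 mu (U f)) :
  selfadjoint mu U -> symop (@L2rip _ _ mu s r) (liftL2 U2).
Proof.
move=> aU f g; rewrite /L2rip /rip /=.
by rewrite (hadjoint_tinner aU (L2funP f) (L2funP g)).
Qed.

Lemma bddop_liftL2 U (U2 : forall f, L2 mu f -> L2 mu (U f)) :
  (exists K : R, forall f, L2 mu f -> rip mu (U f) (U f) <= K * rip mu f f) ->
  bddop (@L2rip _ _ mu s r) (liftL2 U2).
Proof. by move=> [K UK]; exists K => f; apply: UK; exact: L2funP. Qed.

Lemma bijective_id_add P : bounded_mx_sym P ->
  (forall f, L2 mu f -> 0 <= rip mu (P f) f) -> L2_bijective mu (fun f => f + P f).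
Proof.
move=> bP P0; have [P2 bdP sP] := bP.
have [V2 _ sV] := bounded_mx_symD bounded_mx_sym_id bP.
split=> [f g f2 g2 Vfg|g g2].
  have d2 := L2B f2 g2; have Pd2 := P2 _ d2; have Vd2 := L2D d2 Pd2.
  (* For injectivity, [d = f - g] satisfies [|d|^2 + rip (P d) d = 0] with both terms
     nonnegative. *)
  have dV0 : rip mu (f - g) ((f - g) + P (f - g)) = 0.
    by rewrite ripBl// /rip /tinner -!sV// (minner_aeq (V2 f f2) (V2 g g2) Vfg d2) subrr.
  move: dV0; rewrite (ripC d2 Vd2) (ripDl d2 Pd2 d2) => dV0.
  by apply/aeqE; have := P0 _ d2; have := rip_ge0 d2; lra.
have [||f0|f fE] := @id_add_pos_surj _ _ _ (liftL2 P2) (toL2 g2) (psform_L2rip mu s r)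
  (@L2rip_complete _ _ mu s r).
- by apply: symop_liftL2; exact: mx_sym_selfadjoint.
- exact: bddop_liftL2.
- exact: P0 (L2funP f0).
exists f; first exact: L2funP.
have f2 := L2funP f; have Vf2 := V2 f f2.
apply: aeq_of_rip => // h h2; apply/esym; apply: rip_aeq => //.
exact/aeqE.
Qed.

Lemma mx_riesz_id_add P (E : nat -> Fn) : mx_onb mu E -> bounded_mx_sym P ->
  (forall f, L2 mu f -> 0 <= rip mu (P f) f) ->
  mx_riesz mu (fun k => E k + P (E k)).
Proof.
move=> onbE bP P0; have bV := bounded_mx_symD bounded_mx_sym_id bP.
exists E, (fun f => f + P f); split.
- exact: onbE.
- exact: bounded_mx_sym_blop.
- exact: bijective_id_add.
- exact: bounded_mx_sym_adjointable.
- move=> k; have [E2 _ _] := onbE; have [V2 _ _] := bV.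
  by apply: aeq_of_rip => //; exact: V2.
Qed.

End Operators.

(** * The square root of the square *)

Section SquareRoot.
Context (R : realType) (G : topologicalZmodType)
  (mu : {measure set (borelType G) -> \bar R}) (s r : nat).
Notation Fn := (borelType G -> 'M[R[i]]_(s, r)).
Context (S T : Fn -> Fn) (bT : bounded_mx_sym mu T)
  (sqrtS : is_pos_sqrt mu (fun f => T (T f)) S).
Implicit Types f g h : Fn.

Let S2 f : L2 mu f -> L2 mu (S f).
Proof. by have [[[+ _ _ _] _ _] _] := sqrtS; apply. Qed.

Let T2 f : L2 mu f -> L2 mu (T f).
Proof. by have [+ _ _] := bT; apply. Qed.

Let sT f g : L2 mu f -> L2 mu g -> minner mu (T f) g = minner mu f (T g).
Proof. by have [_ _ +] := bT; apply. Qed.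

Let selfS : selfadjoint mu S.
Proof. by have [[]] := sqrtS. Qed.

Let adS f g : L2 mu f -> L2 mu g -> tinner mu (S f) g = tinner mu f (S g).
Proof. exact: hadjoint_tinner. Qed.

Let bdS : exists K : R, forall f, L2 mu f -> rip mu (S f) (S f) <= K * rip mu f f.
Proof.
by have [[[_ _ _ [K SK]] _ _] _] := sqrtS; exists K => f f2; rewrite -!nsqE; exact: SK.
Qed.

Let S_ge0 f : L2 mu f -> 0 <= rip mu (S f) f.
Proof.
move=> f2; have [[_ _ S0] _] := sqrtS; have := S0 f f2.
by rewrite ipE lecE => /andP[].
Qed.

(** Both sides are the pairing of [T (T f)] with [f]. *)
Let rip_sqrt f : L2 mu f -> rip mu (S f) (S f) = rip mu (T f) (T f).
Proof.
move=> f2; have [_ /(_ f f2) SS] := sqrtS.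
have Sf2 := S2 f2; have Tf2 := T2 f2; have SSf2 := S2 Sf2; have TTf2 := T2 Tf2.
by rewrite /rip -adS// /tinner (minner_aeq SSf2 TTf2 SS f2) sT.
Qed.

Let rip_unitary (A : 'M[R[i]]_s) f : unitarymx A -> L2 mu f ->
  rip mu (fun x => A *m f x) (fun x => A *m f x) = rip mu f f.
Proof.
move=> [A1 _] f2; rewrite /rip tinnerMl//; last exact: L2M.
congr (complex.Re (tinner mu f _)); apply/funext => x.
by rewrite mulmxA A1 mul1mx.
Qed.

(** Symmetry of [T] for the matrix-valued product makes it commute weakly with left multiplication
    by [A], which preserves norms. *)
Let rip_T_unitary (A : 'M[R[i]]_s) f : unitarymx A -> L2 mu f ->
  rip mu (T (fun x => A *m f x)) (T (fun x => A *m f x)) = rip mu (T f) (T f).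
Proof.
move=> Au f2; have Af2 := L2M A f2; have Tf2 := T2 f2; have ATf2 := L2M A Tf2.
have TAf2 := T2 Af2; rewrite -(rip_unitary Au Tf2).
have comm h : L2 mu h ->
    minner mu (T (fun x => A *m f x)) h = minner mu (fun x => A *m T f x) h.
  move=> h2; have Th2 := T2 h2.
  by rewrite sT// minnerMl// minnerMl// sT.
by rewrite /rip /tinner comm// (minnerC TAf2 ATf2) comm// -minnerC.
Qed.

(* Conjugating [S] by a unitary matrix yields another positive square root of [T^2]. *)
Lemma sqrt_unitary_conj (A : 'M[R[i]]_s) f g : unitarymx A -> L2 mu f -> L2 mu g ->
  rip mu (S f) g = rip mu (fun x => A *m S (fun y => ctr A *m f y) x) g.
Proof.
move=> Au f2 g2; have Au' := unitarymx_ctr Au.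
pose S' h : Fn := fun x => A *m S (fun y => ctr A *m h y) x.
have S'2 h : L2 mu h -> L2 mu (S' h).
  by move=> h2; apply: L2M; apply: S2; exact: L2M.
have S'sym : selfadjoint mu S'.
  move=> h k h2 k2; have Ah2 := L2M (ctr A) h2; have Ak2 := L2M (ctr A) k2.
  have SAh2 := S2 Ah2; have SAk2 := S2 Ak2.
  rewrite !ipE /S' tinnerMl// adS// tinnerMl//.
  congr (tinner mu h _); apply/funext => x; by rewrite ctrK.
have nS' h : L2 mu h -> rip mu (S' h) (S' h) = rip mu (S h) (S h).
  move=> h2; have Ah2 := L2M (ctr A) h2; have SAh2 := S2 Ah2.
  by rewrite rip_unitary// !rip_sqrt// rip_T_unitary.
have uniq := @pos_sqrt_unique _ _ (@L2rip _ _ mu s r) (liftL2 S2) (liftL2 S'2)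
  (psform_L2rip mu s r) (symop_liftL2 S2 selfS) (symop_liftL2 S'2 S'sym).
apply: (uniq _ _ _ _ _ (toL2 f2) (toL2 g2)).
- exact: bddop_liftL2.
- apply: bddop_liftL2; have [K SK] := bdS; exists K => h h2.
  by rewrite nS'//; exact: SK.
- by move=> h; exact: S_ge0 (L2funP h).
- move=> h; have h2 := L2funP h; have Ah2 := L2M (ctr A) h2.
  rewrite /L2rip /rip /= tinnerMl//; last exact: S2.
  exact: S_ge0 Ah2.
- by move=> h; apply/esym; exact: nS' (L2funP h).
Qed.

(** The traces of [A] times [minner (S f) g] and [minner f (S g)] are the pairings of [A *m S f] and
    [S (A *m f)] with [g]. For unitary [A] these agree, by [sqrt_unitary_conj] at [A *m f]. *)
Lemma sqrt_bounded_mx_sym : bounded_mx_sym mu S.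
Proof.
split; [exact: S2|exact: bdS|].
move=> f g f2 g2; apply/subr0_eq/unitary_trace_eq0 => A Au.
have Sf2 := S2 f2; have Sg2 := S2 g2; have Af2 := L2M A f2.
have SAf2 := S2 Af2; have ASf2 := L2M A Sf2.
rewrite mulmxBr linearB/= -!minnerMl// -!/(tinner mu _ _) -adS//.
apply/eqP; rewrite subr_eq0; apply/eqP/esym.
apply: (tinner_of_rip SAf2 ASf2) => // h h2; rewrite (sqrt_unitary_conj Au Af2 h2).
congr (rip mu _ h); apply/funext => x; congr (_ *m S _ x); apply/funext => y.
by rewrite mulmxA (proj1 Au) mul1mx.
Qed.

Lemma sqrt_dominates U f : bounded_mx_sym mu U ->
  (forall h, L2 mu h -> rip mu (U h) (U h) <= rip mu (T h) (T h)) -> L2 mu f ->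
  rip mu (U f) f <= rip mu (S f) f.
Proof.
move=> [U2 bU sU] UT f2.
have selfU := mx_sym_selfadjoint sU.
apply: (@heinz _ _ (@L2rip _ _ mu s r) (liftL2 S2) (liftL2 U2) (psform_L2rip mu s r)
  (symop_liftL2 S2 selfS) (symop_liftL2 U2 selfU) _ _ _ (toL2 f2)).
- exact: bddop_liftL2.
- by move=> k; exact: S_ge0 (L2funP k).
- move=> k; have k2 := L2funP k; have := UT _ k2.
  by rewrite -rip_sqrt.
Qed.

(** [U] stands for [T] and for [-T]. Positivity of [S + U] is [sqrt_dominates] applied to [-U]. *)
Lemma mx_riesz_sqrt_add U (E : nat -> Fn) : mx_onb mu E -> bounded_mx_sym mu U ->
  (forall h, L2 mu h -> rip mu (U h) (U h) = rip mu (T h) (T h)) ->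
  mx_riesz mu (fun k x => E k x + 2^-1 *: (S (E k) x + U (E k) x)).
Proof.
move=> onbE bU UT; have [U2 _ _] := bU.
have half : (2^-1 : R)%:C = 2^-1 by rewrite fmorphV rmorph_nat.
pose P f : Fn := 2^-1 *: (S f + U f).
have bP : bounded_mx_sym mu P.
  have := bounded_mx_symZ 2^-1 (bounded_mx_symD sqrt_bounded_mx_sym bU).
  by rewrite half.
apply: (mx_riesz_id_add onbE bP) => f f2.
have Sf2 := S2 f2; have Uf2 := U2 f f2; have SU2 := L2D Sf2 Uf2.
have NUf2 := L2N Uf2.
rewrite /P -half ripZl// ripDl//; apply: mulr_ge0; first by rewrite invr_ge0.
have := sqrt_dominates (bounded_mx_symN bU) _ f2.
rewrite ripNl// -subr_ge0 opprK; apply => h h2.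
have Uh2 := U2 h h2; have NUh2 := L2N Uh2.
by rewrite ripNl// (ripC Uh2 NUh2) ripNl// opprK UT.
Qed.

End SquareRoot.

Theorem theorem3p15 (R : realType) (G : topologicalZmodType)
  (mu : {measure set (borelType G) -> \bar R}) (s r : nat)
  (T S : (borelType G -> 'M[R[i]]_(s, r)) -> (borelType G -> 'M[R[i]]_(s, r)))
  (E : nat -> borelType G -> 'M[R[i]]_(s, r)) :
  (0 < s)%N -> (0 < r)%N ->
  metrizable_top R G -> loc_compact G -> sigma_compact G ->
  haar_measure mu ->
  blop mu T -> selfadjoint mu T -> mx_adjointable mu T ->
  mx_onb mu E ->
  is_pos_sqrt mu (fun f => T (T f)) S ->
  mx_riesz mu (fun k x => E k x + 2^-1 *: (S (E k) x + T (E k) x)) /\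
  mx_riesz mu (fun k x => E k x + 2^-1 *: (S (E k) x - T (E k) x)).
Proof.
move=> _ _ _ _ _ _ blT selfT adjT onbE sqrtS.
have bT := selfadjoint_mx_sym blT selfT adjT; have [T2 _ _] := bT.
split; first exact: (mx_riesz_sqrt_add bT sqrtS onbE bT).
apply: (mx_riesz_sqrt_add bT sqrtS onbE (bounded_mx_symN bT)) => h h2.
have Th2 := T2 h h2; have NTh2 := L2N Th2.
by rewrite ripNl// (ripC Th2 NTh2) ripNl// opprK.
Qed.
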